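(* Let $q\geq 1$ and $n\geq 3$ be integers and let $X$ be a connected $(q+1)$-regular undirected graph of finite order $n$ (loops and multiple edges allowed). Let $\{h_k\}_{k=1}^\infty$ be the sequence of Maclaurin coefficients given by $\frac{d}{du}\ln \Xi(q^{-\frac12}u)=\sum_{k=0}^\infty h_{k+1}u^k$, where $\Xi$ is the Ihara xi function of $X$. Then the following are equivalent: (i) $X$ is Ramanujan. (ii) $h_k\geq 0$ for all $k\geq 1$. (iii) $h_k\geq 0$ for infinitely many even $k\geq 2$.
   Context: Graphs: $X$ is an undirected graph of finite order (number of vertices) $n$, loops and multiple edges allowed. Each edge (including each loop) is given two opposite orientations, called oriented edges. The valency of a vertex $x$ is the number of oriented edges with initial vertex $x$; $X$ is $(q+1)$-regular if every vertex has valency $q+1$. The adjacency matrix $A$ has $(x,y)$-entry equal to the number of oriented edges from $x$ to $y$; its (real) eigenvalues are the eigenvalues of $X$. A walk is a nonempty finite sequence of oriented edges in which the terminal vertex of each is the initial vertex of the next; its length is the number of oriented edges. $X$ is connected if there is a walk between any two distinct vertices. A cycle is a walk from a vertex to itself; $X$ is bipartite if all cycles have even length. A walk has backtracking if some oriented edge is immediately followed by its opposite. A cycle is geodesic if all its cyclic shifts are backtrackless. $N_k$ ($k\ge1$) is the number of geodesic cycles of length $k$. The Ihara zeta function $Z(u)$ is the analytic continuation of $\exp\left(\sum_{k=1}^\infty \frac{N_k}{k}u^k\right)$. Eigenvalues of $X$ with absolute value $q+1$ are trivial; the others are nontrivial. $X$ is Ramanujan if $|\lambda|\le 2q^{\frac12}$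 for all nontrivial eigenvalues $\lambda$ of $X$. The Ihara xi function $\Xi(u)$ is defined by $$\Xi(u)^{-1}=(1-u)(1-qu)(1-q^{\frac12}u)^{2n-2}(1-u^2)^{\frac{n(q-1)}{2}}Z(u)$$ if $X$ is nonbipartite, and by $$\Xi(u)^{-1}=(1-q^2u^2)(1-q^{\frac12}u)^{2n-4}(1-u^2)^{\frac{n(q-1)}{2}+1}Z(u)$$ if $X$ is bipartite. *)

(* Defs.v *)
From HB Require Import structures.
From mathcomp Require Import all_boot all_order all_algebra complex.
From mathcomp Require Import all_classical all_reals all_analysis.

Set Implicit Arguments.
Unset Strict Implicit.
Unset Printing Implicit Defensive.

Import Order.TTheory GRing.Theory Num.Theory numFieldNormedType.Exports.
Local Open Scope classical_set_scope.
Local Open Scope ring_scope.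
Local Open Scope complex_scope.

(* Finite undirected graph with loops and multiple edges, given by its oriented
   edges: an unoriented edge is a pair {e, opp e}.  Since [opp] has no fixed
   point, a loop also carries two distinct orientations. *)
Record multigraph := Multigraph {
  vertex : finType;
  oedge : finType;
  src : oedge -> vertex;
  tgt : oedge -> vertex;
  opp : oedge -> oedge;
  oppK : involutive opp;
  opp_neq : forall e, opp e != e;
  src_opp : forall e, src (opp e) = tgt e
}.

Definition graph_order (X : multigraph) : nat := #|vertex X|.

Definition valency (X : multigraph) (x : vertex X) : nat :=
  #|[set e : oedge X | src e == x]%SET|.

Definition regular (X : multigraph) (d : nat) : Prop :=
  forall x : vertex X, valency x = d.

Definition is_walk (X : multigraph) (x y : vertex X) (w : seq (oedge X)) : bool :=
  if w is e :: s then
    [&& path (fun a b => tgt a == src b) e s, src e == x & tgt (last e s) == y]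
  else false.

Definition connected_graph (X : multigraph) : Prop :=
  forall x y : vertex X, x != y -> exists w, is_walk x y w.

Definition is_cycle (X : multigraph) (w : seq (oedge X)) : bool :=
  [exists x : vertex X, is_walk x x w].

Definition bipartite (X : multigraph) : Prop :=
  forall w : seq (oedge X), is_cycle w -> ~~ odd (size w).

Definition backtrackless (X : multigraph) (w : seq (oedge X)) : bool :=
  sorted (fun a b => b != opp a) w.

Definition geodesic (X : multigraph) (w : seq (oedge X)) : bool :=
  is_cycle w && [forall i : 'I_(size w), backtrackless (rot i w)].

Definition nb_geodesic (X : multigraph) (k : nat) : nat :=
  #|[set w : k.-tuple (oedge X) | geodesic w]%SET|.

Definition adjacency (R : realType) (X : multigraph) : 'M[R]_(graph_order X) :=
  \matrix_(i, j)
    #|[set e : oedge X | (src e == enum_val i) && (tgt e == enum_val j)]%SET|%:R.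

Definition ramanujan (R : realType) (X : multigraph) (q : nat) : Prop :=
  forall lambda : R, eigenvalue (adjacency R X) lambda ->
    `|lambda| != q%:R + 1 -> `|lambda| <= 2 * Num.sqrt q%:R.

(* [R[i]^o] is the type [R[i]] with its canonical structure of normed space over
   itself, so that [derivable] and [is_derive] in direction 1 are complex
   differentiability. *)

Definition expC (R : realType) (z : R[i]^o) : R[i]^o :=
  (expR (complex.Re z))%:C * (cos (complex.Im z) +i* sin (complex.Im z)).

(* Principal argument, with values in ]-pi, pi] for z != 0 *)
Definition argC (R : realType) (z : R[i]^o) : R :=
  let t := acos (complex.Re z / Normc.normc z) in
  if 0 <= complex.Im z then t else - t.

Definition lnC (R : realType) (z : R[i]^o) : R[i]^o :=
  ln (Normc.normc z) +i* argC z.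

(* Z is the analytic continuation of exp (\sum_(k >= 1) N_k / k * u ^ k): it
   agrees with it near 0 and is holomorphic on the complex plane outside a finite
   set of poles.  This determines Z outside the poles, where its values are
   left arbitrary. *)
Definition ihara_zeta (R : realType) (X : multigraph) (Z : R[i]^o -> R[i]^o) :
    Prop :=
  (exists S : set R[i]^o,
     [/\ finite_set S, ~ S 0 & forall u, ~ S u -> derivable Z u 1]) /\
  (\forall u \near (0 : R[i]^o), exists2 l : R[i]^o,
     series (fun k => (nb_geodesic X k.+1)%:R / k.+1%:R * u ^+ k.+1 : R[i]^o)
       @ \oo --> l
     & Z u = expC l).

(* For a (q+1)-regular graph of order n, n * (q + 1) is the number of oriented
   edges, so that n * (q - 1) is even and its halving is exact. *)
Definition ihara_xi (R : realType) (X : multigraph) (q : nat)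
    (Z : R[i]^o -> R[i]^o) (u : R[i]^o) : R[i]^o :=
  let n := graph_order X in
  let q12 : R[i]^o := (Num.sqrt (q%:R : R))%:C in
  (if `[< bipartite X >] then
     (1 - q%:R ^+ 2 * u ^+ 2) * (1 - q12 * u) ^+ (2 * n - 4)
       * (1 - u ^+ 2) ^+ ((n * (q - 1))./2 + 1) * Z u
   else
     (1 - u) * (1 - q%:R * u) * (1 - q12 * u) ^+ (2 * n - 2)
       * (1 - u ^+ 2) ^+ (n * (q - 1))./2 * Z u)^-1.

(* d/du ln f(u) = \sum_(k >= 0) h_(k+1) u ^ k near 0; h_0 plays no role.  The
   principal logarithm is the relevant one when f takes values near 1. *)
Definition dln_maclaurin (R : realType) (f : R[i]^o -> R[i]^o) (h : nat -> R) :
    Prop :=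
  \forall u \near (0 : R[i]^o), exists2 d : R[i]^o,
    is_derive u (1 : R[i]^o) (fun t => lnC (f t)) d
    & series (fun k => (h k.+1)%:C * u ^+ k : R[i]^o) @ \oo --> d.

(* Main.v *)
Require Import Defs.
From HB Require Import structures.
From mathcomp Require Import all_boot all_order all_algebra complex.
From mathcomp Require Import all_classical all_reals all_analysis.
From mathcomp Require Import ring lra zify.

Set Implicit Arguments.
Unset Strict Implicit.
Unset Printing Implicit Defensive.

Import Order.TTheory GRing.Theory Num.Theory numFieldNormedType.Exports.
Local Open Scope ring_scope.
Local Open Scope complex_scope.

(** The number N_k of geodesic cycles is the trace of the k-th power of the
    Hashimoto operator B = T S^T - J on oriented edges, where S, T are the source
    and target incidence matrices and J reverses orientation.  Since J S = T,
    J T = S, S^T T = A and S^T S = T^T T = q + 1, powers of B telescope into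
    Chebyshev-like polynomials of the adjacency matrix A, and N_k becomes
    [\sum_j (alpha_j ^ k + beta_j ^ k)] plus [n (q - 1)] for even k, with
    alpha_j, beta_j the roots of X^2 - lambda_j X + q.  The elementary factors of
    Xi cancel exactly the trivial eigenvalues, so
    [h_k = \sum_(j nontrivial) (2 - t_k(lambda_j / sqrt q))], where
    t_k(2 cos x) = 2 cos (k x).  Each term is nonnegative if
    |lambda_j| <= 2 sqrt q; otherwise it tends to -oo along even k, while every
    other term stays at most 4. *)

Section IndexedMatrices.
Variable F : comNzRingType.
Implicit Types T U V : finType.

Definition fmx T U (f : T -> U -> F) : 'M[F]_(#|T|, #|U|) :=
  \matrix_(i, j) f (enum_val i) (enum_val j).

Lemma fmx_ext T U (f g : T -> U -> F) : f =2 g -> fmx f = fmx g.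
Proof. by move=> fg; apply/matrixP=> i j; rewrite !mxE fg. Qed.

Lemma fmx_mul T U V (f : T -> U -> F) (g : U -> V -> F) :
  fmx f *m fmx g = fmx (fun x z => \sum_y f x y * g y z).
Proof.
apply/matrixP=> i j; rewrite !mxE [RHS]big_enum_val.
by apply: eq_bigr => k _; rewrite !mxE.
Qed.

Lemma fmx_tr T (f : T -> T -> F) : \tr (fmx f) = \sum_x f x x.
Proof.
by rewrite /mxtrace [RHS]big_enum_val; apply: eq_bigr => k _; rewrite !mxE.
Qed.

Lemma trmx_fmx T U (f : T -> U -> F) : (fmx f)^T = fmx (fun y x => f x y).
Proof. by apply/matrixP=> i j; rewrite !mxE. Qed.

Lemma fmx_scalar T (a : F) : a%:M = fmx (fun x y : T => a *+ (x == y)).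
Proof.
by apply/matrixP=> i j; rewrite !mxE (inj_eq enum_val_inj).
Qed.

Lemma sum_delta T (a : T) (g : T -> F) :
  \sum_x (x == a)%:R * g x = g a.
Proof.
rewrite (bigD1 a) //= eqxx mul1r big1 ?addr0 // => x /negPf->.
by rewrite mul0r.
Qed.

Definition relmx T (b : rel T) : 'M[F]_#|T| := fmx (fun x y => (b x y)%:R).

Lemma relmx_exprS T (b : rel T) k :
  relmx b ^+ k.+1 =
  fmx (fun x y => \sum_(p : k.-tuple T) (path b x (rcons p y))%:R).
Proof.
elim: k => [|k IH].
  rewrite expr1; apply: fmx_ext => x y.
  rewrite (big_pred1 [tuple]) /= ?andbT // => p; apply/esym/eqP.
  exact: tuple0.
rewrite exprS IH -[_ * _]/(_ *m _) fmx_mul; apply: fmx_ext => x y.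
rewrite (reindex (fun zp : T * k.-tuple T => [tuple of zp.1 :: zp.2])) /=.
  rewrite -(pair_bigA _ (fun z (p : k.-tuple T) =>
     (b x z && path b z (rcons p y))%:R : F)) /=.
  apply: eq_bigr => z _; rewrite big_distrr /=; apply: eq_bigr => p _.
  by rewrite -natrM mulnb.
exists (fun w => (thead w, [tuple of behead w])) => [[z p] _|w _] /=.
  by congr (_, _); apply: val_inj.
by case/tupleP: w => z p; apply: val_inj.
Qed.

Lemma trace_relmx_exprS T (b : rel T) k :
  \tr (relmx b ^+ k.+1) = #|[set w : k.+1.-tuple T | cycle b w]%SET|%:R.
Proof.
rewrite relmx_exprS fmx_tr -sum1_card natr_sum [RHS]big_mkcond /=.
rewrite (reindex (fun zp : T * k.-tuple T => [tuple of zp.1 :: zp.2])) /=.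
  rewrite (pair_bigA _ (fun z (p : k.-tuple T) =>
     (path b z (rcons p z))%:R : F)) /=.
  by apply: eq_bigr => zp _; rewrite inE /=; case: path.
exists (fun w => (thead w, [tuple of behead w])) => [[z p] _|w _] /=.
  by congr (_, _); apply: val_inj.
by case/tupleP: w => z p; apply: val_inj.
Qed.

End IndexedMatrices.

Section Chebyshev.
Variable r : pzRingType.

(* If alpha, beta are the roots of X^2 - a X + q, then [chebU q a k] is
   (alpha ^ k - beta ^ k) / (alpha - beta) and [chebT q a k] is
   alpha ^ k + beta ^ k. *)

Fixpoint chebU (q : nat) (a : r) (k : nat) : r :=
  if k is k1.+1 then
    if k1 is k2.+1 then a * chebU q a k1 - chebU q a k2 *+ q else 1
  else 0.
#[global] Arguments chebU : simpl never.

Lemma chebU0 q a : chebU q a 0 = 0. Proof. by []. Qed.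

Lemma chebU1 q a : chebU q a 1 = 1. Proof. by []. Qed.

Definition chebT q a k := chebU q a k.+1 *+ 2 - a * chebU q a k.

Lemma chebUSS q a k : chebU q a k.+2 = a * chebU q a k.+1 - chebU q a k *+ q.
Proof. by []. Qed.

End Chebyshev.

Section Hashimoto.
Variables (F : comNzRingType) (X : multigraph) (q : nat).

Definition hashimoto_rel : rel (oedge X) :=
  fun a b => (tgt a == src b) && (b != Defs.opp a).

Lemma geodesicE w : (0 < size w)%N -> geodesic w = cycle hashimoto_rel w.
Proof.
case: w => // e s _; rewrite /geodesic.
have -> : cycle hashimoto_rel (e :: s) =
    cycle (fun a b => tgt a == src b) (e :: s)
    && cycle (fun a b => b != Defs.opp a) (e :: s) by exact: path_relI.
congr (_ && _).
  rewrite /is_cycle /= rcons_path; apply/existsP/andP => [[x]|[p /eqP t]].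
    by case/and3P=> p /eqP <- /eqP ->; rewrite p eqxx.
  by exists (src e); rewrite p t !eqxx.
apply/forallP/idP => [bt|c i].
  have p0 : backtrackless (e :: s) by have := bt ord0; rewrite rot0.
  rewrite /backtrackless /= in p0.
  rewrite /= rcons_path p0 /=.
  case: s p0 bt => [|a s] p0 bt; first by rewrite eq_sym opp_neq.
  have := bt (Ordinal (isT : (1 < size [:: e, a & s])%N)).
  by rewrite [rot _ _]rot1_cons /backtrackless /= rcons_path => /andP[].
rewrite /backtrackless; move: c; rewrite -(rot_cycle i).
by case: (rot i _) => //= a t; rewrite rcons_path => /andP[].
Qed.

Lemma nb_geodesic_trace k :
  (nb_geodesic X k.+1)%:R = \tr (relmx F hashimoto_rel ^+ k.+1).
Proof.
rewrite trace_relmx_exprS; congr (_%:R); apply: eq_card => w.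
by rewrite !inE geodesicE // size_tuple.
Qed.

Definition adjmx : 'M[F]_#|vertex X| :=
  fmx (fun x y => #|[set e : oedge X | (src e == x) && (tgt e == y)]%SET|%:R).

Definition srcmx : 'M[F]_(#|oedge X|, #|vertex X|) :=
  fmx (fun e x => (src e == x)%:R).
Definition tgtmx : 'M[F]_(#|oedge X|, #|vertex X|) :=
  fmx (fun e x => (tgt e == x)%:R).
Definition oppmx : 'M[F]_#|oedge X| := fmx (fun e f => (f == Defs.opp e)%:R).

Lemma tgt_opp (e : oedge X) : tgt (Defs.opp e) = src e.
Proof. by rewrite -src_opp oppK. Qed.

Lemma sum_indic (g : pred (oedge X)) :
  \sum_e (g e)%:R = #|[set e | g e]%SET|%:R :> F.
Proof.
rewrite -sum1_card natr_sum [RHS]big_mkcond /=.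
by apply: eq_bigr => e _; rewrite inE; case: (g e).
Qed.

Lemma hashimotoE :
  relmx F hashimoto_rel = tgtmx *m srcmx^T - oppmx.
Proof.
rewrite trmx_fmx fmx_mul; apply/matrixP => i j; rewrite !mxE.
set e := enum_val i; set f := enum_val j.
rewrite (bigD1 (tgt e)) //= eqxx mul1r big1 ?addr0; last first.
  by move=> x; rewrite eq_sym => /negPf->; rewrite mul0r.
rewrite /hashimoto_rel eq_sym; have [->|] /= := eqVneq f (Defs.opp e).
  by rewrite src_opp eqxx subrr.
by rewrite andbT subr0.
Qed.

Lemma srcmx_tr_tgtmx : srcmx^T *m tgtmx = adjmx.
Proof.
rewrite trmx_fmx fmx_mul; apply: fmx_ext => x y; rewrite -sum_indic.
by apply: eq_bigr => e _; rewrite -natrM mulnb.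
Qed.

Lemma oppmx_srcmx : oppmx *m srcmx = tgtmx.
Proof.
rewrite fmx_mul; apply: fmx_ext => e x.
by rewrite sum_delta src_opp.
Qed.

Lemma oppmx_sqr : oppmx *m oppmx = 1%:M.
Proof.
rewrite fmx_mul fmx_scalar; apply: fmx_ext => e f.
by rewrite sum_delta oppK eq_sym.
Qed.

Lemma oppmx_tgtmx : oppmx *m tgtmx = srcmx.
Proof. by rewrite -oppmx_srcmx mulmxA oppmx_sqr mul1mx. Qed.

Lemma oppmx_tr : oppmx^T = oppmx.
Proof.
rewrite trmx_fmx; apply: fmx_ext => e f; congr ((_ : bool)%:R).
by apply/eqP/eqP => ->; rewrite oppK.
Qed.

Lemma tgtmx_tr_srcmx : tgtmx^T *m srcmx = adjmx.
Proof.
rewrite -oppmx_srcmx trmx_mul oppmx_tr -mulmxA oppmx_srcmx.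
exact: srcmx_tr_tgtmx.
Qed.

Lemma adjmx_tr : adjmx^T = adjmx.
Proof. by rewrite -{1}srcmx_tr_tgtmx trmx_mul trmxK tgtmx_tr_srcmx. Qed.

Lemma trace_oppmx : \tr oppmx = 0.
Proof.
by rewrite fmx_tr big1 // => e _; rewrite eq_sym (negPf (opp_neq e)).
Qed.

Hypothesis Xreg : regular X (q + 1).

Lemma srcmx_tr_srcmx : srcmx^T *m srcmx = (q + 1)%:R%:M.
Proof.
rewrite trmx_fmx fmx_mul fmx_scalar; apply: fmx_ext => x y.
have [<-|xy] := eqVneq x y.
  rewrite mulr1n -(Xreg x) -sum_indic; apply: eq_bigr => e _.
  by rewrite -natrM mulnb andbb.
rewrite mulr0n big1 // => e _; rewrite -natrM mulnb.
by have [->|] //= := eqVneq (src e) x; rewrite (negPf xy).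
Qed.

Lemma tgtmx_tr_tgtmx : tgtmx^T *m tgtmx = (q + 1)%:R%:M.
Proof.
rewrite -{1}oppmx_srcmx trmx_mul oppmx_tr -mulmxA oppmx_tgtmx.
exact: srcmx_tr_srcmx.
Qed.

Lemma card_oedge : #|oedge X| = (#|vertex X| * (q + 1))%N.
Proof.
rewrite -sum1_card (partition_big (@src X) xpredT) //= -sum_nat_const.
apply: eq_bigr => x _; rewrite -(Xreg x) sum1_card.
by apply: eq_card => e; rewrite !inE.
Qed.

Local Notation B := (relmx F hashimoto_rel).

Lemma hashimoto_tgtmx : B *m tgtmx = tgtmx *m adjmx - srcmx.
Proof.
by rewrite hashimotoE mulmxBl -mulmxA srcmx_tr_tgtmx oppmx_tgtmx.
Qed.

Lemma hashimoto_srcmx : B *m srcmx = tgtmx *+ q.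
Proof.
rewrite hashimotoE mulmxBl -mulmxA srcmx_tr_srcmx oppmx_srcmx.
by rewrite mul_mx_scalar natrD scalerDl scale1r addrK scaler_nat.
Qed.

Lemma hashimoto_exp_tgtmx k :
  B ^+ k *m tgtmx =
  tgtmx *m chebU q adjmx k.+1 - srcmx *m chebU q adjmx k.
Proof.
elim: k => [|k IH]; first by rewrite expr0 mul1mx chebU0 chebU1 mulmx0 subr0 mulmx1.
rewrite exprS -[B * _]/(B *m _) -mulmxA IH mulmxBr !mulmxA.
rewrite hashimoto_tgtmx hashimoto_srcmx chebUSS mulmxBl mulmxBr.
rewrite -[_ * chebU q adjmx k.+1]/(_ *m _) !mulmxA.
rewrite addrAC; congr (_ - _ - _).
by rewrite -!scaler_nat -scalemxAl -scalemxAr.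
Qed.

Lemma hashimoto_expSS k :
  B ^+ k.+2 = B ^+ k.+1 *m tgtmx *m srcmx^T - B ^+ k *m tgtmx *m tgtmx^T
              + B ^+ k.
Proof.
have BJ : B *m oppmx = tgtmx *m tgtmx^T - 1%:M.
  rewrite hashimotoE mulmxBl oppmx_sqr -mulmxA; congr (_ *m _ - _).
  by rewrite -oppmx_srcmx trmx_mul oppmx_tr.
rewrite exprSr -[_ * B]/(_ *m B) [X in _ *m X]hashimotoE mulmxBr mulmxA.
rewrite -addrA; congr (_ + _); rewrite {1}exprSr -[_ * B]/(_ *m B) -(mulmxA _ B) BJ.
by rewrite mulmxBr mulmx1 mulmxA opprB addrC.
Qed.

Lemma trace_hashimoto_exp k :
  \tr (B ^+ k) = \tr (chebT q adjmx k)
    + (#|oedge X|%:R - (#|vertex X| * 2)%:R) *+ ~~ odd k.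
Proof.
suff: \tr (B ^+ k) = \tr (chebT q adjmx k)
    + (#|oedge X|%:R - (#|vertex X| * 2)%:R) *+ ~~ odd k
  /\ \tr (B ^+ k.+1) = \tr (chebT q adjmx k.+1)
    + (#|oedge X|%:R - (#|vertex X| * 2)%:R) *+ ~~ odd k.+1 by case.
elim: k => [|k [IH1 IH2]]; split=> //.
- rewrite /chebT chebU0 chebU1 mulr0 subr0 raddfMn /= !mxtrace1 natrM mulr_natr.
  by rewrite addrC subrK.
- rewrite expr1 hashimotoE raddfB /= mxtrace_mulC srcmx_tr_tgtmx trace_oppmx.
  by rewrite /chebT chebUSS chebU0 chebU1 mul0rn !subr0 mulr1 mulr2n addrK addr0.
rewrite hashimoto_expSS raddfD raddfB /= IH1 negbK.
rewrite mxtrace_mulC [X in _ - X + _]mxtrace_mulC !hashimoto_exp_tgtmx.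
rewrite /chebT (chebUSS q adjmx k.+1) {IH1 IH2}.
move: (chebU q adjmx k.+2) (chebU q adjmx k.+1) (chebU q adjmx k) => U2 U1 U0.
rewrite !mulmxBr !mulmxA srcmx_tr_tgtmx srcmx_tr_srcmx tgtmx_tr_tgtmx.
rewrite tgtmx_tr_srcmx !mul_scalar_mx -![adjmx *m _]/(_ * _).
by rewrite !(raddfB, raddfMn) /= !mxtraceZ natrD; ring.
Qed.

End Hashimoto.

Section Walks.
Variable X : multigraph.
Implicit Types (x y z : vertex X) (w : seq (oedge X)).

Lemma is_walk_cons x y e w :
  is_walk x y (e :: w) =
  (src e == x) && (if w is [::] then tgt e == y else is_walk (tgt e) y w).
Proof.
rewrite /is_walk; case: w => [|a w] //=.
rewrite [tgt e == _]eq_sym; case: (src e == x); last by rewrite andbF.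
by rewrite /= -andbA [RHS]andbCA.
Qed.

Lemma is_walk_cat x y z w1 w2 :
  is_walk x y w1 -> is_walk y z w2 -> is_walk x z (w1 ++ w2).
Proof.
elim: w1 x => [//|e w1 IH] x; rewrite cat_cons !is_walk_cons => /andP[-> /=].
case: w1 IH => [_ /eqP -> /=|a w1 IH]; first by case: w2.
exact: IH.
Qed.

Lemma is_walk_rev x y w :
  is_walk x y w -> is_walk y x (rev (map (@Defs.opp X) w)).
Proof.
elim: w x => [//|e w IH] x; rewrite is_walk_cons => /andP[/eqP <-].
have step z : tgt e == z -> is_walk z (src e) [:: Defs.opp e].
  by move=> /eqP <-; rewrite is_walk_cons src_opp tgt_opp !eqxx.
rewrite map_cons rev_cons -cats1; case: w IH => [_|a w IH]; first exact: step.
by move=> /IH /is_walk_cat; apply; apply: step.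
Qed.

Lemma walk_mul (F : pzRingType) (c : F) (f : vertex X -> F) :
  (forall e, f (tgt e) = c * f (src e)) ->
  forall x y w, is_walk x y w -> f y = c ^+ size w * f x.
Proof.
move=> fc x y w; elim: w x => [//|e w IH] x.
rewrite is_walk_cons => /andP[/eqP <-].
case: w IH => [_ /eqP <-|a w IH /IH ->]; first by rewrite expr1.
by rewrite fc [in RHS]exprSr mulrA.
Qed.

Hypothesis Xconn : connected_graph X.

Lemma walk_mul_eq0 (F : pzRingType) (c : F) (f : vertex X -> F) x :
  (forall e, f (tgt e) = c * f (src e)) -> f x = 0 -> forall y, f y = 0.
Proof.
move=> fc fx y; have [<-//|/Xconn[w /(walk_mul fc) ->]] := eqVneq x y.
by rewrite fx mulr0.
Qed.

Lemma bipartite_coloring (F : pzRingType) :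
  bipartite X -> (forall x, exists e : oedge X, src e = x) ->
  exists2 f : vertex X -> F,
    (forall x, f x = 1 \/ f x = -1) & forall e, f (tgt e) = - f (src e).
Proof.
move=> Xbip Xne.
have [[x0]|noV] := pselect (inhabited (vertex X)); last first.
  by exists (fun=> 1) => [|e]; [left | case: noV; exists; exact: (src e)].
have walkP x : exists w, is_walk x0 x w.
  have [<-|] := eqVneq x0 x; last exact: Xconn.
  have [e <-] := Xne x0; exists [:: e; Defs.opp e].
  by rewrite !is_walk_cons eqxx src_opp tgt_opp !eqxx.
pose odd_walk x := exists2 w, is_walk x0 x w & odd (size w).
have odd_walkS e : odd_walk (tgt e) <-> ~ odd_walk (src e).
  have e1 : is_walk (src e) (tgt e) [:: e] by rewrite is_walk_cons !eqxx.
  split=> [[w1 W1 o1] [w2 W2 o2]|no].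
    have := is_walk_cat (is_walk_cat W2 e1) (is_walk_rev W1).
    move=> cyc; have /Xbip : is_cycle ((w2 ++ [:: e]) ++ rev (map (@Defs.opp X) w1)).
      by apply/existsP; exists x0.
    by rewrite !size_cat size_rev size_map !oddD o1 o2.
  have [w W] := walkP (src e); exists (w ++ [:: e]); first exact: is_walk_cat e1.
  by rewrite size_cat addn1 /=; apply/negP => ow; apply: no; exists w.
exists (fun x => if `[< odd_walk x >] then -1 else 1) => [x|e].
  by case: ifP; [right | left].
case: (asboolP (odd_walk (src e))) => o; case: asboolP => //.
- by move=> /odd_walkS.
- by rewrite opprK.
- by case; apply/odd_walkS.
Qed.

End Walks.

Section Spectrum.
Local Open Scope ring_scope.
Variables (C : numClosedFieldType) (X : multigraph) (q : nat).
Hypothesis Xreg : regular X (q + 1).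

Local Notation A := (adjmx C X).

Lemma card_tgt (y : vertex X) : #|[set e : oedge X | tgt e == y]%SET| = (q + 1)%N.
Proof.
rewrite -(Xreg y) -(card_imset _ (inv_inj (@oppK X))).
apply: eq_card => e; rewrite !inE; apply/imsetP/eqP => [[f + ->]|<-].
  by rewrite inE src_opp => /eqP.
by exists (Defs.opp e); rewrite ?inE ?tgt_opp ?oppK.
Qed.

Lemma mul_adjmxE (v : 'rV[C]_#|vertex X|) (y : vertex X) :
  (v *m A) 0 (enum_rank y) = \sum_(e | tgt e == y) v 0 (enum_rank (src e)).
Proof.
rewrite mxE [RHS](partition_big (@src X) xpredT) //= [RHS]big_enum_val /=.
apply: eq_bigr => i _; rewrite mxE enum_rankK mulr_natr.
rewrite (eq_bigr (fun=> v 0 i)); last first.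
  by move=> e /andP[_ /eqP ->]; rewrite enum_valK.
rewrite sumr_const; congr (_ *+ _); apply: eq_card => e.
by rewrite !inE andbC.
Qed.

Lemma sum_oedge_src (g : vertex X -> C) :
  \sum_(e : oedge X) g (src e) = (\sum_x g x) *+ (q + 1).
Proof.
rewrite (partition_big (@src X) xpredT) //= -sumrMnl; apply: eq_bigr => x _.
rewrite (eq_bigr (fun=> g x)); last by move=> e /eqP ->.
by rewrite sumr_const -(Xreg x); congr (_ *+ _); apply: eq_card => e; rewrite inE.
Qed.

Lemma sum_oedge_opp (g : oedge X -> C) : \sum_e g (Defs.opp e) = \sum_e g e.
Proof. by rewrite [RHS](reindex_inj (inv_inj (@oppK X))). Qed.

(* The sum over oriented edges of
   [`|f (tgt e) - (-1) ^+ b * f (src e)| ^+ 2] vanishes on an eigenvector. *)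
Lemma extremal_eigenvector (b : bool) (f : vertex X -> C) :
  (forall y, \sum_(e | tgt e == y) f (src e) = (-1) ^+ b * (q + 1)%:R * f y) ->
  forall e, f (tgt e) = (-1) ^+ b * f (src e).
Proof.
move=> fA; pose eps : C := (-1) ^+ b.
have epsC : eps^* = eps by rewrite rmorphXn /= rmorphN rmorph1.
have eps2 : eps * eps = 1 by rewrite -expr2 sqrr_sign.
pose nn := \sum_x f x * (f x)^*.
have S2 : \sum_(e : oedge X) f (src e) * (f (src e))^* = nn *+ (q + 1).
  exact: (sum_oedge_src (fun x => f x * (f x)^*)).
have S1 : \sum_(e : oedge X) f (tgt e) * (f (tgt e))^* = nn *+ (q + 1).
  by rewrite -S2 -[RHS]sum_oedge_opp; apply: eq_bigr => e _; rewrite src_opp.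
have S3 : \sum_(e : oedge X) f (src e) * (f (tgt e))^* = eps * nn *+ (q + 1).
  rewrite (partition_big (@tgt X) xpredT) //=.
  rewrite -mulrnAr /nn -sumrMnl mulr_sumr; apply: eq_bigr => y _.
  rewrite (eq_bigr (fun e => f (src e) * (f y)^*)); last by move=> e /eqP ->.
  by rewrite -mulr_suml fA -mulr_natr /eps; ring.
have S4 : \sum_(e : oedge X) f (tgt e) * (f (src e))^* = eps * nn *+ (q + 1).
  by rewrite -S3 -[RHS]sum_oedge_opp; apply: eq_bigr => e _; rewrite src_opp tgt_opp.
have : \sum_(e : oedge X) `|f (tgt e) - eps * f (src e)| ^+ 2 = 0.
  transitivity (\sum_(e : oedge X) (f (tgt e) * (f (tgt e))^*
      + f (src e) * (f (src e))^* - eps * (f (src e) * (f (tgt e))^*)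
      - eps * (f (tgt e) * (f (src e))^*))).
    apply: eq_bigr => e _; rewrite normCK rmorphB rmorphM /= epsC.
    rewrite -[in RHS](mul1r (f (src e) * (f (src e))^*)) -eps2; ring.
  rewrite !sumrB big_split /= -!mulr_sumr S1 S2 S3 S4.
  rewrite -!mulrnAr !mulrA eps2; ring.
move/psumr_eq0P => /(_ (fun e _ => exprn_ge0 2 (normr_ge0 _))) H e.
by have /eqP := H e isT; rewrite sqrf_eq0 normr_eq0 subr_eq0 => /eqP.
Qed.

Lemma extremal_eigenvector_mx (b : bool) (v : 'rV[C]_#|vertex X|) :
  v *m A = ((-1) ^+ b * (q + 1)%:R) *: v ->
  forall e, v 0 (enum_rank (tgt e)) = (-1) ^+ b * v 0 (enum_rank (src e)).
Proof.
move=> vA; apply: (extremal_eigenvector (f := fun x => v 0 (enum_rank x))) => y.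
by rewrite -mul_adjmxE vA mxE.
Qed.

Lemma extremal_eigenvalueE (b : bool) (f : vertex X -> C) (x : vertex X) :
  (forall e, f (tgt e) = (-1) ^+ b * f (src e)) -> f x != 0 ->
  eigenvalue A ((-1) ^+ b * (q + 1)%:R).
Proof.
move=> fe fx; apply/eigenvalueP; exists (\row_i f (enum_val i)); last first.
  apply: contra fx => /eqP /rowP /(_ (enum_rank x)).
  by rewrite !mxE enum_rankK => ->.
apply/rowP => k; rewrite -[k]enum_valK mul_adjmxE !mxE enum_valK.
set y := enum_val k; rewrite (eq_bigr (fun=> (-1) ^+ b * f y)); last first.
  by move=> e /eqP <-; rewrite mxE enum_rankK fe mulrA -expr2 sqrr_sign mul1r.
rewrite sumr_const -(card_tgt y).
rewrite mulrAC mulr_natr; congr (_ *+ _).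
by apply: eq_card => e; rewrite !inE.
Qed.

Hypothesis Xconn : connected_graph X.

Lemma nonbipartite_eigenvalue :
  ~ bipartite X -> ~~ eigenvalue A (- (q + 1)%:R).
Proof.
move=> Xnb; apply/negP => /eigenvalueP[v vA /negP[]].
have ve e : v 0 (enum_rank (tgt e)) = - 1 * v 0 (enum_rank (src e)).
  by apply: (@extremal_eigenvector_mx true); rewrite expr1 mulN1r.
apply/eqP/rowP=> k; rewrite mxE -[k]enum_valK.
have [w /existsP[x cw] ow] : exists2 w : seq (oedge X), is_cycle w & odd (size w).
  apply: contrapT => nw; apply: Xnb => w cw; apply/negP => ow.
  by apply: nw; exists w.
apply: (walk_mul_eq0 (F := C) (f := fun x => v 0 (enum_rank x)) (x := x)
          Xconn ve _ (enum_val k)).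
have := walk_mul (f := fun x => v 0 (enum_rank x)) ve cw.
rewrite -signr_odd ow expr1 mulN1r => /eqP.
by rewrite -addr_eq0 -mulr2n mulrn_eq0 => /eqP.
Qed.

Lemma extremal_eigenvalue_simple (b : bool) (P : 'M[C]_#|vertex X|) i j :
  P \in unitmx ->
  row i P *m A = ((-1) ^+ b * (q + 1)%:R) *: row i P ->
  row j P *m A = ((-1) ^+ b * (q + 1)%:R) *: row j P -> i = j.
Proof.
move=> Pu iA jA; apply/eqP/negPn/negP => ij.
pose x := enum_val i.
pose c k := P k (enum_rank x).
pose v := c j *: row i P - c i *: row j P.
have v0 : v = 0.
  have ve : v *m A = ((-1) ^+ b * (q + 1)%:R) *: v.
    by rewrite mulmxBl -!scalemxAl iA jA scalerBr !scalerA !(mulrC _ (c _)).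
  apply/rowP=> k; rewrite [RHS]mxE -[k]enum_valK.
  apply: (walk_mul_eq0 (F := C) (f := fun x => v 0 (enum_rank x)) (x := x) Xconn
            (extremal_eigenvector_mx ve) _ (enum_val k)).
  by rewrite /v !mxE /c mulrC subrr.
have : c j *: delta_mx 0 i - c i *: delta_mx 0 j = 0 :> 'rV[C]_#|vertex X|.
  apply: (can_inj (mulmxK Pu)).
  by rewrite mul0mx mulmxBl -!scalemxAl -!rowE.
move=> /rowP /(_ j); rewrite !mxE !eqxx eq_sym (negPf ij) mulr0 mulr1 add0r.
move=> /eqP; rewrite oppr_eq0 => /eqP ci0.
have : row i P = 0.
  apply/rowP=> k; rewrite [RHS]mxE -[k]enum_valK.
  apply: (walk_mul_eq0 (F := C) (f := fun x => row i P 0 (enum_rank x)) (x := x)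
            Xconn
            (extremal_eigenvector_mx iA) _ (enum_val k)).
  by rewrite mxE.
rewrite rowE => /(congr1 (mulmx^~ (invmx P))); rewrite mulmxK // mul0mx.
by move=> /rowP /(_ i); rewrite !mxE !eqxx => /eqP; rewrite oner_eq0.
Qed.

End Spectrum.

Section Diagonalization.

Lemma chebT_rmorph (F K : pzRingType) (phi : {rmorphism F -> K}) q a k :
  chebT q (phi a) k = phi (chebT q a k).
Proof.
have U j : chebU q (phi a) j = phi (chebU q a j) /\
           chebU q (phi a) j.+1 = phi (chebU q a j.+1).
  elim: j => [|j [IH1 IH2]]; first by rewrite !chebU0 !chebU1 rmorph0 rmorph1.
  by split=> //; rewrite !chebUSS IH1 IH2 rmorphB rmorphM rmorphMn.
by rewrite /chebT (U k).2 (U k).1 rmorphB rmorphMn rmorphM.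
Qed.

Lemma trace_chebT_diag (F : fieldType) n (P : 'M[F]_n) (d : 'rV[F]_n) q k :
  P \in unitmx ->
  \tr (chebT q (invmx P *m diag_mx d *m P) k) = \sum_j chebT q (d 0 j) k.
Proof.
move=> Pu; set A := invmx P *m _ *m P.
have U j : chebU q A j = invmx P *m diag_mx (\row_l chebU q (d 0 l) j) *m P /\
   chebU q A j.+1 = invmx P *m diag_mx (\row_l chebU q (d 0 l) j.+1) *m P.
  elim: j => [|j [IH1 IH2]].
    split.
      rewrite chebU0 (_ : diag_mx _ = 0) ?mulmx0 ?mul0mx //.
      by apply/matrixP=> a b; rewrite !mxE chebU0 mul0rn.
    rewrite chebU1 (_ : diag_mx _ = 1%:M) ?mulmx1 ?mulVmx //.
    by apply/matrixP=> a b; rewrite !mxE chebU1.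
  split=> //; rewrite chebUSS IH1 IH2 -[A * _]/(A *m _).
  rewrite /A !mulmxA mulmxK // -(mulmxA (invmx P) (diag_mx d)).
  rewrite mulmx_diag -scaler_nat.
  have -> : diag_mx (\row_l chebU q (d 0 l) j.+2) =
    diag_mx (\row_l (d 0 l * (\row_m chebU q (d 0 m) j.+1) 0 l))
    - q%:R *: diag_mx (\row_l chebU q (d 0 l) j).
    apply/matrixP=> a b; rewrite !mxE chebUSS mulrnBl mulrnAr mulr_natl.
    by rewrite -!mulrnA mulnC.
  by rewrite mulmxBr mulmxBl -scalemxAr -scalemxAl.
rewrite /chebT (U k).2 (U k).1 -[A * _]/(A *m _) /A !mulmxA mulmxK //.
rewrite raddfB raddfMn /= -(mulmxA (invmx P) (diag_mx d)) mulmx_diag.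
rewrite ![\tr (_ *m P)]mxtrace_mulC !mulmxA !mulmxV // !mul1mx !mxtrace_diag.
by rewrite -sumrMnl -sumrB; apply: eq_bigr => j _; rewrite !mxE.
Qed.

Lemma diag_similar_eigenvalue (F : fieldType) n (P : 'M[F]_n) (d : 'rV[F]_n) a :
  P \in unitmx ->
  eigenvalue (invmx P *m diag_mx d *m P) a <-> exists j, d 0 j = a.
Proof.
move=> Pu; split=> [/eigenvalueP[v vA v0]|[j <-]]; last first.
  apply/eigenvalueP; exists (row j P).
    rewrite rowE !mulmxA mulmxK // -rowE row_diag_mx.
    by rewrite -scalemxAl.
  apply/eqP; rewrite rowE => /(congr1 (mulmx^~ (invmx P))).
  rewrite mulmxK // mul0mx => /rowP /(_ j); rewrite !mxE !eqxx => /eqP.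
  by rewrite oner_eq0.
pose w := v *m invmx P.
have w0 : w != 0.
  by apply: contra v0 => /eqP w0; rewrite -(mulmxKV Pu v) -/w w0 mul0mx.
have wD : w *m diag_mx d = a *: w.
  rewrite /w -(mulmxK Pu (_ *m diag_mx d)) -!mulmxA (mulmxA (diag_mx d)).
  by rewrite (mulmxA (invmx P)) (mulmxA (invmx P)) mulmxA vA scalemxAl.
have /rV0Pn[j wj] := w0; exists j; apply: (mulfI wj).
move/rowP: wD => /(_ j); rewrite mul_mx_diag !mxE => ->.
exact: mulrC.
Qed.

Variables (R : realType) (X : multigraph) (q : nat).
Hypotheses (Xreg : regular X (q + 1)) (Xconn : connected_graph X).
Hypothesis q_gt0 : (0 < q)%N.
Hypothesis Xne : (0 < graph_order X)%N.

Lemma adjacency_map : map_mx (real_complex R) (adjacency R X) = adjmx R[i] X.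
Proof. by apply/matrixP=> a b; rewrite !mxE rmorph_nat. Qed.

Lemma graph_spectrum : exists d : 'I_#|vertex X| -> R,
  [/\ forall a, eigenvalue (adjacency R X) a <-> exists j, d j = a,
      forall k, (nb_geodesic X k.+1)%:R =
        \sum_j chebT q (d j) k.+1
        + (#|vertex X| * (q - 1))%:R *+ ~~ odd k.+1,
      exists j, d j = (q + 1)%:R,
      (exists j, d j = - (q + 1)%:R) <-> bipartite X &
      forall j l, (d j == (q + 1)%:R) || (d j == - (q + 1)%:R) ->
        d j = d l -> j = l].
Proof.
pose A := adjmx R[i] X.
have Aherm : A \is hermsymmx.
  apply: realsym_hermsym; last by apply/mxOverP=> a b; rewrite mxE realn.
  by apply/is_hermitianmxP; rewrite expr0 scale1r /A adjmx_tr map_mx_id.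
have Au := spectral_unit A; set P := spectralmx A in Au.
have /orthomx_spectralP := hermitian_normalmx Aherm.
rewrite -/P; set D := spectral_diag A => AE.
pose d j := complex.Re (D 0 j).
have dE j : (d j)%:C = D 0 j.
  by apply: RRe_real; apply/mxOverP: 0 j; exact: hermitian_spectral_diag_real.
have eigE a : eigenvalue (adjacency R X) a <-> exists j, d j = a.
  rewrite -(eigenvalue_map (real_complex R)) adjacency_map -/A AE.
  rewrite diag_similar_eigenvalue //.
  split=> -[j]; first by rewrite -dE => /complexI <-; exists j.
  by move=> <-; exists j; exact/esym/dE.
have extE (b : bool) : eigenvalue A ((-1) ^+ b * (q + 1)%:R) <->
    exists j, d j = (-1) ^+ b * (q + 1)%:R.
  rewrite -eigE -(eigenvalue_map (real_complex R)) adjacency_map -/A.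
  by rewrite rmorphM rmorph_sign rmorph_nat.
have rowPA j : row j P *m A = (d j)%:C *: row j P.
  rewrite dE {1}AE rowE !mulmxA mulmxK // -rowE row_diag_mx.
  by rewrite -scalemxAl -rowE.
have [x0 _] := card_gt0P Xne.
have Xe x : exists e : oedge X, src e = x.
  have : (0 < #|[set e : oedge X | src e == x]%SET|)%N.
    by rewrite -/(valency x) Xreg addn1.
  by case/card_gt0P => e; rewrite inE => /eqP; exists e.
exists d; split=> //.
- move=> k; apply: (@complexI R); rewrite rmorph_nat nb_geodesic_trace.
  rewrite (trace_hashimoto_exp _ Xreg) rmorphD rmorph_sum rmorphMn rmorph_nat.
  congr (_ + _ *+ _).
    rewrite -/A AE trace_chebT_diag //; apply: eq_bigr => j _.
    by rewrite -chebT_rmorph -dE.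
  rewrite (card_oedge Xreg) -natrB; last by rewrite leq_mul2l addn1 ltnS q_gt0 orbT.
  by rewrite -mulnBr; congr (_ * _)%:R; lia.
- have [|j dj] := (extE false).1; last by exists j; rewrite dj mul1r.
  apply: (@extremal_eigenvalueE _ _ _ Xreg false (fun=> 1) x0).
    by move=> e; rewrite mul1r.
  exact: oner_neq0.
- split=> [[j dj]|Xb].
    apply: contrapT => /(nonbipartite_eigenvalue R[i] Xreg Xconn) /negP; apply.
    by rewrite -mulN1r; apply: (extE true).2; exists j; rewrite dj mulN1r.
  have [|j dj] := (extE true).1; last by exists j; rewrite dj mulN1r.
  have [f f1 fe] := bipartite_coloring Xconn R[i] Xb Xe.
  apply: (@extremal_eigenvalueE _ _ _ Xreg true f x0).
    by move=> e; rewrite fe mulN1r.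
  by case: (f1 x0) => ->; rewrite ?oppr_eq0 oner_neq0.
- move=> j l dj djl.
  have [b db] : exists b : bool, d j = (-1) ^+ b * (q + 1)%:R.
    case/orP: dj => /eqP ->; first by exists false; rewrite mul1r.
    by exists true; rewrite mulN1r.
  have dbC : (d j)%:C = (-1) ^+ b * (q + 1)%:R.
    by rewrite db rmorphM rmorph_sign rmorph_nat.
  apply: (@extremal_eigenvalue_simple _ _ _ Xreg Xconn b P) => //.
    by rewrite rowPA dbC.
  by rewrite rowPA -djl dbC.
Qed.

End Diagonalization.

Section ChebyshevScalar.
Variable R : realType.
Implicit Types (q k : nat) (a x y s : R).

Lemma chebT_unique q a (g : nat -> R) :
  g 0%N = 2 -> g 1%N = a -> (forall k, g k.+2 = a * g k.+1 - q%:R * g k) ->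
  forall k, chebT q a k = g k.
Proof.
move=> g0 g1 gS k.
suff [] : chebT q a k = g k /\ chebT q a k.+1 = g k.+1 by [].
elim: k => [|k [IH1 IH2]].
  rewrite /chebT chebUSS !chebU0 !chebU1 g0 g1; split; first by rewrite mulr0 subr0.
  by rewrite mul0rn subr0 mulr1 mulr2n addrK.
split=> //; rewrite gS -IH1 -IH2 /chebT !(chebUSS q a k.+1) (chebUSS q a k).
ring.
Qed.

Lemma chebTSS q a k : chebT q a k.+2 = a * chebT q a k.+1 - q%:R * chebT q a k.
Proof. rewrite /chebT !(chebUSS q a k.+1) (chebUSS q a k); ring. Qed.

Lemma chebT0 q a : chebT q a 0 = 2.
Proof. by rewrite /chebT chebU1 chebU0 mulr0 subr0. Qed.

Lemma chebT1 q a : chebT q a 1 = a.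
Proof.
by rewrite /chebT chebUSS chebU1 chebU0 mul0rn subr0 mulr1 mulr2n addrK.
Qed.

Lemma chebT_scale q s x k :
  s ^+ 2 = q%:R -> chebT q (s * x) k = s ^+ k * chebT 1 x k.
Proof.
move=> sq; apply: (chebT_unique (g := fun k => s ^+ k * chebT 1 x k)).
- by rewrite mul1r chebT0.
- by rewrite expr1 chebT1.
- by move=> j; rewrite chebTSS -sq !exprS; ring.
Qed.

Lemma chebT_trivial q k : chebT q ((q + 1)%:R : R) k = q%:R ^+ k + 1.
Proof.
apply: (chebT_unique (g := fun k => q%:R ^+ k + 1)) => [|| j].
- by rewrite expr0.
- by rewrite expr1 natrD.
- rewrite natrD !exprS; ring.
Qed.

Lemma chebTN q a k : chebT q (- a) k = (-1) ^+ k * chebT q a k.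
Proof.
apply: (chebT_unique (g := fun k => (-1) ^+ k * chebT q a k)) => [|| j].
- by rewrite chebT0 mul1r.
- by rewrite chebT1 mulN1r.
- rewrite chebTSS !exprS; ring.
Qed.

Lemma chebT_cos x k : `|x| <= 2 -> chebT 1 x k = 2 * cos (acos (x / 2) *+ k).
Proof.
rewrite ler_norml => /andP[x1 x2].
have xc : cos (acos (x / 2)) = x / 2.
  by rewrite acosK // in_itv /= ler_pdivlMr // ler_pdivrMr // mulN1r mul1r x1.
apply: (chebT_unique (g := fun k => 2 * cos (acos (x / 2) *+ k))) => [|| j].
- by rewrite mulr0n cos0 mulr1.
- by rewrite mulr1n xc mulrC divfK.
- move: (acos (x / 2)) xc => t xc.
  have -> : t *+ j.+2 = t *+ j.+1 + t by rewrite mulrSr.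
  have -> : t *+ j = t *+ j.+1 - t by rewrite mulrSr addrK.
  by rewrite cosD cosB xc; field.
Qed.

Lemma chebT_le2 x k : `|x| <= 2 -> chebT 1 x k <= 2.
Proof. by move=> /chebT_cos ->; rewrite ger_pMr // cos_le1. Qed.

Lemma chebT_double x k : chebT 1 x k.*2 = chebT 1 (x ^+ 2 - 2) k.
Proof.
symmetry; apply: (chebT_unique (g := fun k => chebT 1 x k.*2)) => [|| j].
- exact: chebT0.
- by rewrite chebTSS chebT1 chebT0; ring.
- by rewrite !doubleS !(chebTSS _ _ _.+2) !(chebTSS _ _ _.+1) !chebTSS; ring.
Qed.

Lemma chebT_growth y k : 2 <= y -> 2 + k%:R * (y - 2) <= chebT 1 y k.
Proof.
move=> y2.
suff [] : 2 + k%:R * (y - 2) <= chebT 1 y k /\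
          y - 2 <= chebT 1 y k.+1 - chebT 1 y k by [].
elim: k => [|k [IH1 IH2]]; first by rewrite chebT0 chebT1 mul0r addr0.
have k0 : 0 <= k%:R * (y - 2) by rewrite mulr_ge0 // subr_ge0.
rewrite chebTSS -[k.+1%:R]natr1 mulrDl mul1r.
move: (k%:R * _) (chebT 1 y k.+1) (chebT 1 y k) k0 IH1 IH2 => K t1 t0 K0 IH1 IH2.
have H : 0 <= (y - 2) * t1 by rewrite mulr_ge0 ?subr_ge0 //; lra.
by split; lra.
Qed.

Lemma chebT_even_growth x k :
  2 < `|x| -> 2 + k%:R * (x ^+ 2 - 4) <= chebT 1 x k.*2.
Proof.
move=> x2; rewrite chebT_double.
have x4 : 4 <= x ^+ 2.
  rewrite -real_normK ?num_real // (_ : 4 = 2 ^+ 2); last by rewrite -natrX.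
  by rewrite lerXn2r ?nnegrE // ltW.
have := @chebT_growth (x ^+ 2 - 2) k.
by rewrite (_ : _ - 2 - 2 = x ^+ 2 - 4); [apply; lra | ring].
Qed.

Lemma chebT_even_geN2 x k : -2 <= chebT 1 x k.*2.
Proof.
have [x2|x2] := leP `|x| 2.
  rewrite (chebT_cos _ x2) -mulrN1 ler_pM2l //; exact: cos_geN1.
apply: le_trans (chebT_even_growth k x2).
have x4 : 4 <= x ^+ 2.
  rewrite -real_normK ?num_real // (_ : 4 = 2 ^+ 2); last by rewrite -natrX.
  by rewrite lerXn2r ?nnegrE // ltW.
have : 0 <= k%:R * (x ^+ 2 - 4) by rewrite mulr_ge0 // subr_ge0.
lra.
Qed.

End ChebyshevScalar.

Section ComplexToReal.
Local Open Scope classical_set_scope.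
Variable R : realType.

Lemma normC_real (x : R) : `|x%:C| = `|x|%:C :> R[i].
Proof. by rewrite normc_def /= expr0n addr0 sqrtr_sqr. Qed.

Lemma gt0_complexE (e : R[i]) : 0 < e -> 0 < complex.Re e /\ e = (complex.Re e)%:C.
Proof.
case: e => a b; rewrite ltcE /= => /andP[/eqP -> a0]; split=> //.
Qed.

Lemma cvg_real_complex (u : R) : (t%:C : R[i]^o) @[t --> u] --> (u%:C : R[i]^o).
Proof.
apply/cvgrPdist_lt => e /gt0_complexE[e0 ->]; near=> t.
rewrite -rmorphB /= normC_real ltcR; near: t.
exact: cvgr_dist_lt.
Unshelve. all: by end_near. Qed.

Lemma cvg_Re T (F : set_system T) (FF : Filter F) (f : T -> R[i]^o) (l : R[i]^o) :
  f x @[x --> F] --> l -> complex.Re (f x) @[x --> F] --> complex.Re l.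
Proof.
move=> fl; apply/cvgrPdist_lt => e e0.
have e0C : (0 : R[i]) < e%:C by rewrite ltcR.
move/cvgrPdist_lt : fl => /(_ _ e0C); apply: filterS => x fx.
rewrite -ltcR; apply: le_lt_trans fx.
by rewrite -[_ - _]/(complex.Re _ - complex.Re _) -raddfB normc_ge_Re.
Qed.

Lemma cvg_real_limit (f : nat -> R) (l : R[i]^o) :
  ((f k)%:C : R[i]^o) @[k --> \oo] --> l ->
  f @ \oo --> complex.Re l /\ l = (complex.Re l)%:C.
Proof.
move=> fl.
have fR : f @ \oo --> complex.Re l.
  exact: (@cvg_Re _ _ _ _ _ fl).
split=> //.
have fC : ((f k)%:C : R[i]^o) @[k --> \oo] --> ((complex.Re l)%:C : R[i]^o).
  exact: (@cvg_comp _ _ _ _ _ _ _ _ fR (@cvg_real_complex (complex.Re l))).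
have hausC := @norm_hausdorff (R[i]) (R[i]^o).
exact: (@cvg_unique (R[i]^o) hausC _ _ l (complex.Re l)%:C fl fC).
Qed.

Lemma near_real (P : R[i]^o -> Prop) :
  (\forall u \near (0 : R[i]^o), P u) -> \forall t \near (0 : R), P (t%:C).
Proof. by move=> P0; exact: (@cvg_real_complex 0 P P0). Qed.

Lemma is_derive_real (f : R[i]^o -> R[i]^o) (g : R -> R) (u : R) (d : R[i]^o) :
  is_derive (u%:C : R[i]^o) (1 : R[i]^o) f d ->
  (\forall t \near u, f t%:C = (g t)%:C) ->
  is_derive u (1 : R) g (complex.Re d).
Proof.
move=> [fd <-] fg.
have fgu := nbhs_singleton fg.
have lim : s^-1 *: (g (s *: 1 + u) - g u) @[s --> (0 : R)^'] -->
    complex.Re ('D_(1 : R[i]^o) f (u%:C : R[i]^o)).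
  have C0 : (t%:C : R[i]^o) @[t --> (0 : R)^'] --> (0 : R[i]^o)^'.
    move=> A A0.
    have A0' : \forall z \near (0 : R[i]^o), z != 0 -> A z := A0.
    change (\forall t \near (0 : R), t != 0 -> A t%:C).
    apply: filterS (near_real A0') => t At t0; apply: At.
    by rewrite (inj_eq (@complexI R)).
  have := @cvg_comp _ _ _ _ _ _ _ _ C0 fd.
  move=> /cvg_Re.
  apply: cvg_trans; apply: near_eq_cvg.
  have su : (s + u) @[s --> (0 : R)] --> u.
    rewrite -[X in _ --> X]add0r; apply: cvgD; [exact: cvg_id | exact: cvg_cst].
  have fgs : \forall s \near (0 : R), f (s + u)%:C = (g (s + u))%:C := su _ fg.
  apply: (filterS _ (nbhs_dnbhs fgs)) => s fgs' /=.
  have -> : s%:C%:A + u%:C = (s + u)%:C :> R[i].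
    by rewrite [_%:A]mulr1 rmorphD.
  have -> : s%:A + u = s + u by rewrite [_%:A]mulr1.
  rewrite fgs' fgu.
  have -> : s%:C^-1 *: ((g (s + u))%:C - (g u)%:C) =
      (s^-1 * (g (s + u) - g u))%:C :> R[i].
    by rewrite rmorphM fmorphV rmorphB.
  by [].
split; first by apply/cvg_ex; eexists; exact: lim.
exact: cvg_lim lim.
Qed.

End ComplexToReal.

Section PowerSeries.
Local Open Scope classical_set_scope.
Variable R : realType.
Implicit Types (c e : nat -> R) (M B t : R).

Lemma is_cvg_pseries_bounded c M B t :
  (forall k, `|c k| <= M * B ^+ k) -> `|B * t| < 1 -> cvgn (pseries c t).
Proof.
move=> cM Bt; apply: normed_cvg.
apply: (@series_le_cvg _ _ (fun k => M * `|B * t| ^+ k)) => [k|k|k|].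
- exact: normr_ge0.
- apply: mulr_ge0; last exact: exprn_ge0.
  by have := le_trans (normr_ge0 _) (cM 0%N); rewrite expr0 mulr1.
- rewrite /= 2!normrM exprMn mulrA normrX.
  apply: ler_wpM2r; first exact: exprn_ge0.
  apply: le_trans (cM k) _; apply: ler_wpM2l.
    by have := le_trans (normr_ge0 _) (cM 0%N); rewrite expr0 mulr1.
  by rewrite -normrX ler_norm.
- by apply: is_cvg_geometric_series; rewrite normr_id.
Qed.

Lemma pseries_diffs_bounded c M B :
  (forall k, `|c k| <= M * B ^+ k) ->
  forall k, `|pseries_diffs c k| <= (M * B) * (2 * B) ^+ k.
Proof.
move=> cM k; rewrite /pseries_diffs normrM normr_nat.
have -> : M * B * (2 * B) ^+ k = 2 ^+ k * (M * B ^+ k.+1).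
  by rewrite exprMn exprS; ring.
apply: ler_pM => //.
by rewrite -natrX ler_nat ltn_expl.
Qed.

Lemma is_derive_pseries c M B t : 0 < B ->
  (forall k, `|c k| <= M * B ^+ k) -> `|t| < (8 * B)^-1 ->
  is_derive t (1 : R) (fun x => limn (pseries c x))
    (limn (pseries (pseries_diffs c) t)).
Proof.
move=> B0 cM tB.
have cK a : 0 <= a <= 4 -> `|a * B * (8 * B)^-1| < 1.
  move=> /andP[a0 a4].
  have -> : a * B * (8 * B)^-1 = a / 8 by field; rewrite gt_eqF.
  by rewrite ger0_norm ?divr_ge0 //; lra.
have cM1 := pseries_diffs_bounded cM; have cM2 := pseries_diffs_bounded cM1.
apply: (@pseries_snd_diffs _ _ (8 * B)^-1).
- by apply: is_cvg_pseries_bounded cM _; have := cK 1; rewrite mul1r; apply; lra.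
- by apply: is_cvg_pseries_bounded cM1 _; rewrite cK //; lra.
- by apply: is_cvg_pseries_bounded cM2 _; rewrite [2 * (2 * B)]mulrA cK //; lra.
- by rewrite [ltRHS]ger0_norm // invr_ge0 mulr_ge0 // ltW.
Qed.

Lemma pseries_at0 e : pseries e 0 @ \oo --> e 0%N.
Proof.
rewrite -(cvg_shiftS (pseries e 0)) /=.
apply: cvg_near_cst; apply: nearW => k.
rewrite /pseries /series /= big_nat_recl //= expr0 mulr1 big1 ?addr0 //.
by move=> i _; rewrite expr0n mulr0.
Qed.

Lemma pseries_shift e t (l : R) : t != 0 ->
  e 0%N = 0 -> pseries e t @ \oo --> l -> pseries (fun k => e k.+1) t @ \oo --> l / t.
Proof.
move=> t0 e0 el.
rewrite (_ : pseries _ t = fun k => pseries e t k.+1 / t).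
  by apply: cvgMl; rewrite (cvg_shiftS (pseries e t)).
apply/funext => k; rewrite /pseries /series /= big_nat_recl //= e0 mul0r add0r.
rewrite mulr_suml; apply: eq_bigr => i _.
by rewrite exprSr mulrA mulfK.
Qed.

Lemma pseries_eq0 e (dlt : R) : 0 < dlt ->
  (forall t, t != 0 -> `|t| < dlt -> pseries e t @ \oo --> (0 : R)) ->
  forall k, e k = 0.
Proof.
move=> d0 eP k.
suff e0 e' : (forall t, t != 0 -> `|t| < dlt -> pseries e' t @ \oo --> (0 : R)) ->
    e' 0%N = 0.
  elim: k e eP => [|k IH] e eP; first exact: e0.
  apply: (IH (fun k => e k.+1)) => t t0 td.
  rewrite -(mul0r t^-1); apply: pseries_shift => //; last exact: eP.
  exact: e0.
move=> {}eP; pose r := dlt / 2.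
have r0 : 0 < r by rewrite divr_gt0.
have er : cvgn (pseries e' r).
  apply/cvg_ex; exists 0; apply: eP; first by rewrite gt_eqF.
  by rewrite gtr0_norm // /r; lra.
have [K [_ Kb]] := cvg_series_bounded er.
have eM k' : `|e' k'| <= (`|K| + 1) * r^-1 ^+ k'.
  have := Kb (`|K| + 1) _ k' I; rewrite /= normrM normrX (gtr0_norm r0).
  rewrite exprVn ler_pdivlMr ?exprn_gt0 //; apply.
  by rewrite (le_lt_trans (ler_norm K)) // ltrDl.
have rV0 : 0 < r^-1 by rewrite invr_gt0.
have b0 : 0 < (8 * r^-1)^-1 by rewrite invr_gt0 mulr_gt0.
have := @is_derive_pseries _ _ _ 0 rV0 eM; rewrite normr0 => /(_ b0) [dP _].
have /derivable1_diffP /differentiable_continuous cP := dP.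
have <- : limn (pseries e' 0) = e' 0%N by apply: cvg_lim => //; exact: pseries_at0.
have lim0 : limn (pseries e' t) @[t --> (0:R)^'] --> (0 : R).
  apply: cvg_near_cst; near=> t; apply: cvg_lim => //; apply: eP.
    by near: t; exact: nbhs_dnbhs_neq.
  by near: t; apply: dnbhs0_lt.
have lim1 : limn (pseries e' t) @[t --> (0:R)^'] --> limn (pseries e' 0).
  by apply: cvg_trans cP; apply: cvg_app; exact: nbhs_dnbhs.
exact: cvg_unique lim1 lim0.
Unshelve. all: by end_near. Qed.

End PowerSeries.

Section LogDerivative.
Local Open Scope classical_set_scope.
Variable R : realType.
Implicit Types (L : seq (R * nat)) (c : nat -> R).

Lemma lnC_real (x : R) : 0 < x -> lnC x%:C = (ln x)%:C.
Proof.
move=> x0; rewrite /lnC /argC /= expr0n addr0 sqrtr_sqr gtr0_norm // lexx.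
by rewrite divff ?gt_eqF // acos1.
Qed.

Lemma expC_real (x : R) : expC x%:C = (expR x)%:C.
Proof. by rewrite /expC /= cos0 sin0 mulr1. Qed.

Lemma is_derive_ln_factor (a t : R) : `|a * t| < 1 ->
  is_derive t (1 : R) (fun x => ln (1 - a * x)) (- (a / (1 - a * t))).
Proof.
move=> at1.
have pos : 0 < 1 - a * t by rewrite subr_gt0 (le_lt_trans (ler_norm _)).
have d1 : is_derive t (1 : R) (fun x => 1 - a * x) (- a).
  by apply: is_derive_eq; rewrite add0r mul1r [_%:A]mulr1.
have := @is_derive1_comp _ (@ln R) (fun x => 1 - a * x) t _ _ (is_derive1_ln pos) d1.
by rewrite mulrN mulrC.
Qed.

Lemma cvg_pseries_pow (a t : R) : `|a * t| < 1 ->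
  pseries (fun k => a ^+ k.+1) t @ \oo --> a / (1 - a * t).
Proof.
move=> at1; rewrite (_ : pseries _ t = series (geometric a (a * t))).
  exact: cvg_geometric_series.
apply/funext => k; apply: eq_bigr => i _.
by rewrite /= exprMn mulrA exprS.
Qed.

Definition log_prod L (t : R) := \sum_(p <- L) ln (1 - p.1 * t) *+ p.2.
Definition pow_sum L k : R := \sum_(p <- L) p.1 ^+ k *+ p.2.

Lemma near_small L :
  \forall t \near (0 : R), forall p, p \in L -> `|p.1 * t| < 1.
Proof.
elim: L => [|p L IH]; near=> t => r; first by rewrite in_nil.
rewrite inE => /orP[/eqP ->|]; last first.
  by move: r; near: t.
near: t.
have : p.1 * t @[t --> (0 : R)] --> p.1 * 0 by apply: cvgMr; exact: cvg_id.
by rewrite mulr0 => /cvgr0_norm_lt; apply.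
Unshelve. all: by end_near. Qed.

Lemma ln_prodE L t : (forall p, p \in L -> `|p.1 * t| < 1) ->
  0 < \prod_(p <- L) (1 - p.1 * t) ^+ p.2 /\
  ln (\prod_(p <- L) (1 - p.1 * t) ^+ p.2) = log_prod L t.
Proof.
rewrite /log_prod; elim: L => [|p L IH] H.
  by rewrite !big_nil ln1.
have [|P1 P2] := IH; first by move=> r rL; apply: H; rewrite inE rL orbT.
have p0 : 0 < 1 - p.1 * t.
  by rewrite subr_gt0 (le_lt_trans (ler_norm _)) // H // inE eqxx.
rewrite !big_cons lnM ?posrE ?exprn_gt0 // lnXn // P2.
by rewrite mulr_gt0 ?exprn_gt0.
Qed.

Lemma is_derive_log_prod L t : (forall p, p \in L -> `|p.1 * t| < 1) ->
  exists2 s : R, is_derive t (1 : R) (log_prod L) (- s) &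
    pseries (fun k => pow_sum L k.+1) t @ \oo --> s.
Proof.
elim: L => [|p L IH] H.
  exists 0.
    rewrite oppr0 (_ : log_prod [::] = cst 0); first exact: is_derive_cst.
    by apply/funext => x; rewrite /log_prod big_nil.
  rewrite (_ : pseries _ t = cst 0); first exact: cvg_cst.
  apply/funext => k; rewrite /pseries /series /= big1 // => i _.
  by rewrite /pow_sum big_nil mul0r.
have [|s s1 s2] := IH; first by move=> r rL; apply: H; rewrite inE rL orbT.
have pt : `|p.1 * t| < 1 by apply: H; rewrite inE eqxx.
exists (p.2%:R * (p.1 / (1 - p.1 * t)) + s).
  rewrite (_ : log_prod _ = (p.2%:R *: (fun x => ln (1 - p.1 * x))) + log_prod L).
    apply: is_derive_eq.
      apply: is_deriveD; apply: is_deriveZ; exact: is_derive_ln_factor.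
    by rewrite opprD scalerN.
  by apply/funext => x; rewrite /log_prod big_cons -scaler_nat.
rewrite (_ : pseries _ t = fun k => p.2%:R * pseries (fun k => p.1 ^+ k.+1) t k
                                  + pseries (fun k => pow_sum L k.+1) t k).
  by apply: cvgD => //; apply: cvgMr; exact: cvg_pseries_pow.
apply/funext => k; rewrite /pseries /series /= mulr_sumr -big_split /=.
apply: eq_bigr => i _; rewrite /pow_sum big_cons -mulr_natl; ring.
Qed.

Lemma dln_maclaurin_coef (F : R[i]^o -> R[i]^o) (h : nat -> R) L c (M B : R) :
  0 < B -> (forall k, `|c k| <= M * B ^+ k) ->
  (\forall t \near (0 : R), F t%:C =
    ((\prod_(p <- L) (1 - p.1 * t) ^+ p.2 * expR (limn (pseries c t)))^-1)%:C) ->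
  dln_maclaurin F h ->
  forall k, h k.+1 = pow_sum L k.+1 - k.+1%:R * c k.+1.
Proof.
move=> B0 cM FE hF k.
pose g t := - log_prod L t - limn (pseries c t).
have lnF : \forall t \near (0 : R), lnC (F t%:C) = (g t)%:C.
  near=> t.
  have [|P1 P2] := @ln_prodE L t; first by near: t; exact: near_small.
  have -> : F t%:C = ((\prod_(p <- L) (1 - p.1 * t) ^+ p.2
                       * expR (limn (pseries c t)))^-1)%:C by near: t.
  rewrite lnC_real ?invr_gt0 ?mulr_gt0 ?expR_gt0 //.
  rewrite lnV ?posrE ?mulr_gt0 ?expR_gt0 // lnM ?posrE ?expR_gt0 //.
  by rewrite P2 expRK opprD.
have b0 : 0 < (8 * B)^-1 by rewrite invr_gt0 mulr_gt0.
have : \forall u \near (0 : R),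
    pseries (fun k => h k.+1 - (pow_sum L k.+1 - k.+1%:R * c k.+1)) u @ \oo --> (0 : R).
  near=> u.
  have uB : `|u| < (8 * B)^-1.
    near: u.
    exact: (@nbhs0_lt R R).
  have [|s gs ps] := @is_derive_log_prod L u; first by near: u; exact: near_small.
  have dc := is_derive_pseries B0 cM uB.
  have cc : cvgn (pseries (pseries_diffs c) u).
    apply: is_cvg_pseries_bounded (pseries_diffs_bounded cM) _.
    rewrite normrM gtr0_norm ?mulr_gt0 //.
    have : 2 * B * `|u| < 2 * B * (8 * B)^-1 by rewrite ltr_pM2l // mulr_gt0.
    by rewrite (_ : 2 * B * (8 * B)^-1 = 1 / 4); [lra | field; rewrite gt_eqF].
  have [d Fd hd] : exists2 d : R[i]^o,
      is_derive (u%:C : R[i]^o) (1 : R[i]^o) (fun t => lnC (F t)) d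
      & series (fun k => (h k.+1)%:C * u%:C ^+ k : R[i]^o) @ \oo --> d.
    by near: u; exact: near_real hF.
  have gd : is_derive u (1 : R) g (complex.Re d).
    apply: is_derive_real Fd _.
    by near: u; exact: nbhs_interior lnF.
  have gd' : is_derive u (1 : R) g (s - limn (pseries (pseries_diffs c) u)).
    have -> : s - limn (pseries (pseries_diffs c) u) =
              - - s - limn (pseries (pseries_diffs c) u) by rewrite opprK.
    exact: (is_deriveB (is_deriveN gs) dc).
  have dE : complex.Re d = s - limn (pseries (pseries_diffs c) u).
    by rewrite -(@derive_val _ _ _ _ _ _ _ gd) (@derive_val _ _ _ _ _ _ _ gd').
  have hd' : pseries (fun k => h k.+1) u @ \oo --> complex.Re d.
    rewrite (_ : pseries _ u = fun j => complex.Re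
      (series (fun k => (h k.+1)%:C * u%:C ^+ k : R[i]^o) j)).
      exact: (@cvg_Re _ _ _ _ _ _ hd).
    apply/funext => j.
    rewrite (_ : series _ j = (pseries (fun k => h k.+1) u j)%:C) //.
    rewrite /pseries /series /= rmorph_sum; apply: eq_bigr => i _.
    by rewrite rmorphM rmorphXn.
  rewrite -(subrr (complex.Re d)) [X in _ - X]dE.
  rewrite (_ : pseries _ u = fun j => pseries (fun k => h k.+1) u j
     - (pseries (fun k => pow_sum L k.+1) u j - pseries (pseries_diffs c) u j)).
    by apply: cvgB => //; apply: cvgB.
  apply/funext => j; rewrite /pseries /series /= -!sumrB.
  by apply: eq_bigr => i _; rewrite /pseries_diffs; ring.
move=> /nbhs_ballP[dlt /= d0 hz]; apply/eqP; rewrite -subr_eq0; apply/eqP.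
apply: (@pseries_eq0 _ (fun k => h k.+1 - (pow_sum L k.+1 - k.+1%:R * c k.+1)) _ d0).
move=> t _ td; apply: hz.
by rewrite -ball_normE /= sub0r normrN.
Unshelve. all: by end_near. Qed.

End LogDerivative.

Section IharaXi.
Local Open Scope classical_set_scope.
Variables (R : realType) (X : multigraph) (q : nat).

Lemma card_oedge_even : ~~ odd #|oedge X|.
Proof.
pose A := [set e : oedge X | (enum_rank e < enum_rank (Defs.opp e))%N]%SET.
rewrite -(cardsC A); suff -> : ~: A = [set Defs.opp e | e in A]%SET.
  by rewrite card_imset ?addnn ?odd_double //; exact: inv_inj (@oppK X).
apply/setP=> e; rewrite !inE -leqNgt leq_eqVlt.
rewrite (inj_eq val_inj) (inj_eq enum_rank_inj) (negPf (opp_neq e)) /=.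
apply/idP/imsetP => [lt|[f + ->]].
  by exists (Defs.opp e); rewrite ?inE oppK.
by rewrite inE oppK.
Qed.

Lemma nb_geodesic_le k : (nb_geodesic X k <= #|oedge X| ^ k)%N.
Proof. by rewrite -card_tuple max_card. Qed.

Lemma ihara_zeta_real (Z : R[i]^o -> R[i]^o) : ihara_zeta X Z ->
  \forall t \near (0 : R), Z t%:C =
    (expR (limn (pseries (fun k => (nb_geodesic X k)%:R / k%:R) t)))%:C.
Proof.
case=> _ /near_real; apply: filterS => t [l lP ->].
pose c k : R := (nb_geodesic X k)%:R / k%:R.
have cE (j : nat) : series (fun k => (nb_geodesic X k.+1)%:R / k.+1%:R
    * t%:C ^+ k.+1 : R[i]^o) j = (pseries c t j.+1)%:C.
  rewrite /pseries /series /= big_nat_recl //= /c invr0 mulr0 mul0r add0r.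
  rewrite rmorph_sum; apply: eq_bigr => i _.
  by rewrite rmorphM rmorphXn fmorph_div !rmorph_nat.
have [lR lE] : (fun j => pseries c t j.+1) @ \oo --> complex.Re l /\
    l = (complex.Re l)%:C.
  apply: cvg_real_limit; rewrite (_ : (fun j => _) =
    series (fun k => (nb_geodesic X k.+1)%:R / k.+1%:R * t%:C ^+ k.+1 : R[i]^o)) //.
  by apply/funext => j; rewrite -cE.
rewrite (cvg_shiftS (pseries c t)) in lR.
by rewrite lE expC_real (cvg_lim _ lR).
Qed.

Hypothesis q_gt0 : (0 < q)%N.
Local Notation s := (Num.sqrt (q%:R : R)).
Local Notation n := (graph_order X).

Lemma sqrtq_gt0 : 0 < s. Proof. by rewrite sqrtr_gt0 ltr0n. Qed.

Lemma sqrtq_sqr : s ^+ 2 = q%:R. Proof. by rewrite sqr_sqrtr ?ler0n. Qed.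

(* The pairs (a, m) stand for the factors (1 - a t) ^ m of 1 / Xi besides Z, after
   the substitution u = t / sqrt q. *)
Definition xi_factors : seq (R * nat) :=
  let m := (n * (q - 1))./2 in
  if `[< bipartite X >] then
    [:: (s, 1%N); (- s, 1%N); (1, (2 * n - 4)%N); (s^-1, m.+1); (- s^-1, m.+1)]
  else
    [:: (s^-1, 1%N); (s, 1%N); (1, (2 * n - 2)%N); (s^-1, m); (- s^-1, m)].

Lemma ihara_xi_real (Z : R[i]^o -> R[i]^o) : ihara_zeta X Z ->
  \forall t \near (0 : R), ihara_xi X q Z (s^-1%:C * t%:C) =
   ((\prod_(p <- xi_factors) (1 - p.1 * t) ^+ p.2 *
     expR (limn (pseries (fun k => (nb_geodesic X k)%:R / k%:R * s^-1 ^+ k) t)))^-1)%:C.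
Proof.
move=> /ihara_zeta_real ZR.
have st : s^-1 * t @[t --> (0 : R)] --> (0 : R).
  rewrite -[X in _ --> X](mulr0 s^-1); apply: cvgMr; exact: cvg_id.
have {}ZR : \forall t \near (0 : R), Z (s^-1 * t)%:C = (expR (limn (pseries
  (fun k => (nb_geodesic X k)%:R / k%:R) (s^-1 * t))))%:C := st _ ZR.
apply: filterS ZR => t Zt.
have s0 : s != 0 by rewrite gt_eqF // sqrtq_gt0.
have -> : pseries (fun k => (nb_geodesic X k)%:R / k%:R * s^-1 ^+ k) t =
    pseries (fun k => (nb_geodesic X k)%:R / k%:R) (s^-1 * t).
  by apply/funext => j; apply: eq_bigr => i _; rewrite /= exprMn mulrA.
rewrite -rmorphM /ihara_xi /= Zt /xi_factors; set E := expR _.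
set m := (n * (q - 1))./2; have [u uE] : exists u, u = s^-1 * t by exists (s^-1 * t).
have ut : t = s * u by rewrite uE mulVKf.
have um : (1 - s^-1 * t) * (1 - - s^-1 * t) = 1 - u ^+ 2.
  by rewrite uE; move: s^-1 => r; ring.
have qu : (1 - s * t) * (1 - - s * t) = 1 - q%:R ^+ 2 * u ^+ 2.
  by rewrite -[in RHS]sqrtq_sqr ut; ring.
have qu1 : 1 - s * t = 1 - q%:R * u by rewrite -[in RHS]sqrtq_sqr ut; ring.
rewrite -uE fmorphV; case: ifP => _; congr (_^-1); rewrite [RHS]rmorphM; congr (_ * _).
  rewrite !big_cons big_nil /= !expr1 mulr1 mulrA qu mul1r.
  rewrite -[_ ^+ m.+1 * _]exprMn um ut addn1.
  by rewrite mulrA !(rmorphM, rmorphXn, rmorphB, rmorph1, rmorph_nat).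
rewrite !big_cons big_nil /= !expr1 mulr1 qu1 mul1r -[_ ^+ m * _]exprMn um -uE ut.
by rewrite !mulrA !(rmorphM, rmorphXn, rmorphB, rmorph1, rmorph_nat).
Qed.

End IharaXi.

Section Coefficients.
Variables (R : realType) (X : multigraph) (q : nat).
Hypotheses (q_gt0 : (0 < q)%N) (Xreg : regular X (q + 1)).
Local Notation s := (Num.sqrt (q%:R : R)).
Local Notation n := (graph_order X).

Lemma xi_coef (Z : R[i]^o -> R[i]^o) (h : nat -> R) :
  ihara_zeta X Z ->
  dln_maclaurin (fun u => ihara_xi X q Z (s^-1%:C * u)) h ->
  forall k, h k.+1 =
    pow_sum (xi_factors R X q) k.+1 - (nb_geodesic X k.+1)%:R * s^-1 ^+ k.+1.
Proof.
move=> XZ hF k.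
pose c j : R := (nb_geodesic X j)%:R / j%:R * s^-1 ^+ j.
have s1 : 1 <= s by rewrite -[X in X <= _]sqrtr1 ler_wsqrtr // ler1n.
have cM j : `|c j| <= 1 * (#|oedge X|.+1%:R) ^+ j.
  rewrite mul1r ger0_norm; last first.
    by rewrite mulr_ge0 ?exprn_ge0 ?invr_ge0 ?sqrtr_ge0 // divr_ge0.
  apply: (@le_trans _ _ (nb_geodesic X j)%:R).
    rewrite /c -mulrA ler_piMr //; case: j => [|j]; first by rewrite invr0 mul0r.
    rewrite mulr_ile1 ?exprn_ge0 ?invr_ge0 ?sqrtr_ge0 //.
      by rewrite invf_le1 ?ltr0n // ler1n.
    by rewrite exprn_ile1 ?invr_ge0 ?sqrtr_ge0 // invf_le1 // sqrtq_gt0.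
  rewrite -natrX ler_nat (leq_trans (nb_geodesic_le X j)) //.
  by case: j => // j; rewrite leq_exp2r.
rewrite (dln_maclaurin_coef (ltr0Sn _ _) cM (ihara_xi_real q_gt0 XZ) hF).
by rewrite /c mulrA mulrCA divff ?mulr1 // pnatr_eq0.
Qed.

Lemma half_defect : (n * (q - 1))./2.*2 = (n * (q - 1))%N.
Proof.
apply: even_halfK; have := card_oedge_even X; rewrite (card_oedge Xreg).
by rewrite !oddM addn1 /= subn1 -[q]prednK //= negbK.
Qed.

Hypotheses (Xconn : connected_graph X) (n_ge3 : (3 <= n)%N).

Lemma xi_coef_spectrum (Z : R[i]^o -> R[i]^o) (h : nat -> R) :
  ihara_zeta X Z ->
  dln_maclaurin (fun u => ihara_xi X q Z (s^-1%:C * u)) h ->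
  exists2 d : 'I_n -> R,
    forall a, eigenvalue (adjacency R X) a <-> exists j, d j = a &
    forall k, h k.+1 =
      \sum_(j | `|d j| != q%:R + 1) (2 - chebT 1 (d j / s) k.+1).
Proof.
move=> XZ hF.
have n_gt0 : (0 < n)%N by apply: leq_trans n_ge3.
have [d [dE dN [j1 dj1] dbip duniq]] := graph_spectrum R Xreg Xconn q_gt0 n_gt0.
exists d => // k; rewrite (xi_coef XZ hF) dN.
have s0 := sqrtq_gt0 R q_gt0; have s2 := sqrtq_sqr R q.
have sneq0 : s != 0 by rewrite gt_eqF.
have q1_gt0 : 0 < (q + 1)%:R :> R by rewrite ltr0n addn1.
have q1E : q%:R + 1 = (q + 1)%:R :> R by rewrite natrD.
pose K := k.+1; rewrite -/K.
have chebE a : chebT q a K * s^-1 ^+ K = chebT 1 (a / s) K.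
  have {1}-> : a = s * (a / s) by rewrite mulrC divfK.
  by rewrite (chebT_scale _ _ s2) mulrAC -exprMn divff // expr1n mul1r.
rewrite mulrDl mulr_suml (eq_bigr _ (fun j _ => chebE (d j))).
have top : chebT 1 (d j1 / s) K = s ^+ K + s^-1 ^+ K.
  rewrite -chebE dj1 chebT_trivial mulrDl mul1r; congr (_ + _).
  have -> : q%:R ^+ K = s ^+ K * s ^+ K by rewrite -exprMn -expr2 s2.
  by rewrite -mulrA -exprMn divff // expr1n mulr1.
have bot j : d j = - (q + 1)%:R ->
    chebT 1 (d j / s) K = (-1) ^+ K * (s ^+ K + s^-1 ^+ K).
  by move=> dj; rewrite -chebE dj chebTN -mulrA -top -chebE dj1.
have mE : (n * (q - 1))%:R = (n * (q - 1))./2%:R * 2 :> R.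
  by rewrite -[in LHS]half_defect -muln2 natrM.
have evenE : (~~ odd K)%:R = (1 + (-1) ^+ K) / 2 :> R.
  rewrite -signr_odd; case: (odd K); first by rewrite subrr mul0r.
  by rewrite expr0 /=; field.
have norm_dj j : (`|d j| == q%:R + 1) = (d j == (q + 1)%:R) || (d j == - (q + 1)%:R).
  by rewrite q1E eqr_norml ltW ?andbT.
rewrite -(mulr_natr (n * (q - 1))%:R) evenE mE (bigD1 j1) //= top.
have others (P : pred 'I_n) (c : nat) : (forall j, P j = (`|d j| != q%:R + 1)) ->
    #|P| = c ->
    \sum_(j | `|d j| != q%:R + 1) (2 - chebT 1 (d j / s) K) =
    (2 * c)%:R - \sum_(j | P j) chebT 1 (d j / s) K.
  by move=> PE <-; rewrite -(eq_bigl _ _ PE) sumrB sumr_const natrM mulr_natr.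
have xiE : pow_sum (xi_factors R X q) K =
  if `[< bipartite X >] then
    (s ^+ K + s^-1 ^+ K * (n * (q - 1))./2.+1%:R) * (1 + (-1) ^+ K) + (2 * n - 4)%:R
  else
    s ^+ K + s^-1 ^+ K * (1 + (n * (q - 1))./2%:R * (1 + (-1) ^+ K)) + (2 * n - 2)%:R.
  rewrite /xi_factors /pow_sum; case: ifP => _; rewrite !big_cons big_nil /=.
    by rewrite !expr1n (exprNn s) (exprNn s^-1); ring.
  by rewrite !expr1n (exprNn s^-1); ring.
rewrite xiE; case: asboolP => bip.
  have [j2 dj2] := dbip.2 bip.
  have j21 : j2 != j1.
    apply/eqP => j21; move: dj2; rewrite j21 dj1 => /eqP.
    by rewrite -addr_eq0 gt_eqF // addr_gt0.
  rewrite (bigD1 j2) //= (bot _ dj2).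
  rewrite (others (fun j => (j != j1) && (j != j2)) (n - 2)%N).
  - have -> : (2 * (n - 2) = 2 * n - 4)%N by lia.
    by field.
  - move=> j; rewrite norm_dj negb_or; congr (~~ _ && ~~ _).
      apply/eqP/eqP => [->//|dj]; apply: duniq; rewrite dj ?dj1 ?eqxx //.
    apply/eqP/eqP => [->//|dj]; apply: duniq; rewrite dj ?dj2 ?eqxx ?orbT //.
  - have := cardC (pred2 j1 j2); rewrite card2 eq_sym j21 card_ord.
    rewrite (_ : #|[predC pred2 j1 j2]| = #|(fun j => (j != j1) && (j != j2))|).
      by rewrite /graph_order; move: #|_| #|_| => ? ?; lia.
    by apply: eq_card => j; rewrite !inE negb_or.
rewrite (others (fun j => j != j1) (n - 1)%N).
- have -> : (2 * (n - 1) = 2 * n - 2)%N by lia.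
  by field.
- move=> j; rewrite norm_dj negb_or; have [->|jj1] := eqVneq j j1.
    by rewrite dj1 eqxx.
  apply/esym/andP; split; apply/negP => /eqP dj.
    by move/eqP: jj1; apply; apply: duniq; rewrite dj ?dj1 ?eqxx.
  by apply: bip; apply/dbip; exists j.
- by rewrite cardC1 card_ord subn1.
Qed.

Lemma scaled_norm_le2 (a : R) : (`|a / s| <= 2) = (`|a| <= 2 * s).
Proof.
have s0 := sqrtq_gt0 R q_gt0.
by rewrite normrM normfV (gtr0_norm s0) ler_pdivrMr.
Qed.

End Coefficients.

Theorem theorem1p3 (R : realType) (q n : nat) (X : multigraph)
    (Z : R[i]^o -> R[i]^o) (h : nat -> R) :
  (1 <= q)%N -> (3 <= n)%N -> graph_order X = n ->
  connected_graph X -> regular X (q + 1) ->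
  ihara_zeta X Z ->
  dln_maclaurin
    (fun u => ihara_xi X q Z ((Num.sqrt (q%:R : R))^-1%:C * u)) h ->
  (ramanujan R X q <-> (forall k, (1 <= k)%N -> 0 <= h k)) /\
  (ramanujan R X q <->
     (forall m : nat, exists k, [/\ (m <= k)%N, (2 <= k)%N, ~~ odd k & 0 <= h k])).
Proof.
move=> q_gt0 n_ge3 Xn Xconn Xreg XZ hF.
have n_ge3' : (3 <= graph_order X)%N by rewrite Xn.
have [d dE hE] := xi_coef_spectrum q_gt0 Xreg Xconn n_ge3' XZ hF.
set s := Num.sqrt (q%:R : R) in hE *.
have ramE : ramanujan R X q <->
    forall j, `|d j| != q%:R + 1 -> `|d j / s| <= 2.
  split=> [ram j dj|H a /dE[j <-] dj].
    by rewrite scaled_norm_le2 //; apply: ram => //; apply/dE; exists j.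
  by rewrite -scaled_norm_le2 //; apply: H.
have i_ii : ramanujan R X q -> forall k, (1 <= k)%N -> 0 <= h k.
  move=> /ramE ram [//|k] _; rewrite hE; apply: sumr_ge0 => j dj.
  by rewrite subr_ge0 chebT_le2 // ram.
have ii_iii : (forall k, (1 <= k)%N -> 0 <= h k) -> forall m : nat,
    exists k, [/\ (m <= k)%N, (2 <= k)%N, ~~ odd k & 0 <= h k].
  move=> h0 m; exists m.+1.*2; split; [lia | lia | by rewrite odd_double |].
  by apply: h0; lia.
have iii_i : (forall m : nat,
    exists k, [/\ (m <= k)%N, (2 <= k)%N, ~~ odd k & 0 <= h k]) -> ramanujan R X q.
  move=> inf; apply/ramE => j0 dj0; rewrite leNgt; apply/negP => x2.
  set x := d j0 / s in x2.
  have c0 : 0 < x ^+ 2 - 4.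
    rewrite subr_gt0 -(real_normK (num_real x)) (_ : 4 = 2 ^+ 2) -?natrX //.
    by rewrite natrX ltrXn2r ?nnegrE.
  pose m := Num.bound (4 * (graph_order X)%:R / (x ^+ 2 - 4)).
  have [K [mK K2 Keven]] := inf m.*2.
  have [k Kk] : exists k, K = k.*2 by exists K./2; rewrite even_halfK.
  move: mK K2; rewrite {}Kk leq_double => mk k1; apply/negP; rewrite -ltNge.
  have kgrow : 4 * (graph_order X)%:R < k%:R * (x ^+ 2 - 4).
    rewrite -ltr_pdivrMr //; apply: lt_le_trans (_ : m%:R <= _).
      2: by rewrite ler_nat.
    by apply: archi_boundP; rewrite divr_ge0 ?mulr_ge0 // ltW.
  have -> : k.*2 = k.*2.-1.+1 by lia.
  rewrite hE; have -> : k.*2.-1.+1 = k.*2 by lia.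
  rewrite (bigD1 j0) //= -/x.
  have := chebT_even_growth k x2.
  have : \sum_(i | (`|d i| != q%:R + 1) && (i != j0)) (2 - chebT 1 (d i / s) k.*2)
      <= 4 * (graph_order X)%:R.
    apply: (@le_trans _ _ (\sum_(i : 'I_(graph_order X)) 4)); last first.
      by rewrite sumr_const card_ord mulr_natr.
    rewrite big_mkcond; apply: ler_sum => i _; case: ifP => // _.
    by have := chebT_even_geN2 (d i / s) k; lra.
  move: kgrow; lra.
by split; split=> // H; [apply: iii_i; apply: ii_iii | apply: ii_iii; apply: i_ii].
Qed.
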